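(* Let $\mathbb{S}_1,\mathbb{S}_2,\mathbb{S}_3$ be Borel subsets of Polish spaces, each equipped with the restricted metric, and let $\Psi$ be a stochastic kernel on $\mathbb{S}_1\times\mathbb{S}_2$ given $\mathbb{S}_3$. Then $\Psi$ is semi-uniform Feller if and only if there exists a countable set $\mathbb{F}(\mathbb{S}_1)$ of bounded continuous functions $f:\mathbb{S}_1\to\mathbb{R}$ such that: (1) $\mathbb{F}(\mathbb{S}_1)$ determines weak convergence on $\mathbb{P}(\mathbb{S}_1)$; (2) the constant function $\mathbf{I}_{\mathbb{S}_1}\equiv 1$ on $\mathbb{S}_1$ belongs to $\mathbb{F}(\mathbb{S}_1)$; (3) for every $f\in\mathbb{F}(\mathbb{S}_1)$ and every sequence $\{s_3^{(n)}\}_{n=1,2,\ldots}\subset\mathbb{S}_3$ converging to some $s_3\in\mathbb{S}_3$, $$\lim_{n\to\infty}\ \sup_{B\in\mathcal{B}(\mathbb{S}_2)}\left|\int_{\mathbb{S}_1} f(s_1)\,\Psi(ds_1,B|s_3^{(n)})-\int_{\mathbb{S}_1} f(s_1)\,\Psi(ds_1,B|s_3)\right|=0 .$$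
   Context: For a metric space $\mathbb{S}$, $\mathcal{B}(\mathbb{S})$ denotes its Borel $\sigma$-field and $\mathbb{P}(\mathbb{S})$ the set of probability measures on $(\mathbb{S},\mathcal{B}(\mathbb{S}))$. A sequence $\{\mu^{(n)}\}_{n=1,2,\ldots}\subset\mathbb{P}(\mathbb{S})$ converges weakly to $\mu\in\mathbb{P}(\mathbb{S})$ if $\int_{\mathbb{S}} f\,d\mu^{(n)}\to\int_{\mathbb{S}} f\,d\mu$ for every bounded continuous $f:\mathbb{S}\to\mathbb{R}$. Stochastic kernel: for metric spaces $\mathbb{X},\mathbb{Z}$, a (Borel-measurable) stochastic kernel $\Psi$ on $\mathbb{X}$ given $\mathbb{Z}$ is a mapping $\Psi(\cdot|\cdot):\mathcal{B}(\mathbb{X})\times\mathbb{Z}\to[0,1]$ such that $\Psi(\cdot|z)$ is a probability measure on $\mathbb{X}$ for each $z\in\mathbb{Z}$, and $\Psi(A|\cdot)$ is a Borel-measurable function on $\mathbb{Z}$ for each $A\in\mathcal{B}(\mathbb{X})$. For a stochastic kernel $\Psi$ on $\mathbb{S}_1\times\mathbb{S}_2$ given $\mathbb{S}_3$, write $\Psi(A,B|s_3):=\Psi(A\times B|s_3)$ for $A\in\mathcal{B}(\mathbb{S}_1)$, $B\in\mathcal{B}(\mathbb{S}_2)$, $s_3\in\mathbb{S}_3$; thus, for fixed $B$ and $s_3$, $\Psi(ds_1,B|s_3)$ denotes the finite measure $A\mapsto\Psi(A\times B|s_3)$ on $\mathbb{S}_1$. Semi-uniform Feller: a stochastic kernel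 $\Psi$ on $\mathbb{S}_1\times\mathbb{S}_2$ given $\mathbb{S}_3$ is semi-uniform Feller if, for each sequence $\{s_3^{(n)}\}_{n=1,2,\ldots}\subset\mathbb{S}_3$ converging to $s_3$ in $\mathbb{S}_3$ and for each bounded continuous function $f:\mathbb{S}_1\to\mathbb{R}$, $$\lim_{n\to\infty}\ \sup_{B\in\mathcal{B}(\mathbb{S}_2)}\left|\int_{\mathbb{S}_1} f(s_1)\,\Psi(ds_1,B|s_3^{(n)})-\int_{\mathbb{S}_1} f(s_1)\,\Psi(ds_1,B|s_3)\right|=0 .$$ Determining weak convergence: a set $\mathbb{F}(\mathbb{S})$ of bounded continuous functions $f:\mathbb{S}\to\mathbb{R}$ on a metric space $\mathbb{S}$ determines weak convergence on $\mathbb{P}(\mathbb{S})$ if, for every sequence $\{\mu^{(n)}\}_{n=1,2,\ldots}\subset\mathbb{P}(\mathbb{S})$ and every $\mu\in\mathbb{P}(\mathbb{S})$, $\mu^{(n)}$ converges weakly to $\mu$ if and only if $\int_{\mathbb{S}} f\,d\mu^{(n)}\to\int_{\mathbb{S}} f\,d\mu$ for all $f\in\mathbb{F}(\mathbb{S})$. *)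

(* Defs.v *)
From HB Require Import structures.
From mathcomp Require Import all_boot all_order all_algebra.
From mathcomp Require Import all_classical all_reals all_analysis.

Set Implicit Arguments.
Unset Strict Implicit.
Unset Printing Implicit Defensive.

Import Order.TTheory GRing.Theory Num.Theory.
Import numFieldNormedType.Exports.

Local Open Scope classical_set_scope.
Local Open Scope ring_scope.

Definition polish (R : realType) (T : metricType R) : Prop :=
  (exists2 D : set T, countable D & dense D) /\
  (forall F : set_system T, ProperFilter F -> cauchy F ->
    exists x : T, F --> x).

Definition borel_sets (T : topologicalType) : set (set T) := <<s @open T >>.

(* The restricted metric; it induces the subspace topology that the library
   already puts on set_type. *)
Section restricted_metric.
Context {R : realType} {T : metricType R} (A : set T).

Let dist (x y : A) : R := mdist (set_val x) (set_val y).

Let dist_ge0 x y : 0 <= dist x y.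
Proof. exact: mdist_ge0. Qed.

Let dist_positivity x y : dist x y = 0 -> x = y.
Proof. by move=> /mdist_positivity; exact: val_inj. Qed.

Let ballEdist x d : ball x d = [set y | dist x y < d].
Proof.
by apply/seteqP; split => y; rewrite -initial_ballE /= ballEmdist.
Qed.

HB.instance Definition _ := @PseudoMetric_isMetric.Build R (set_type A)
  dist dist_ge0 dist_positivity ballEdist.

End restricted_metric.

(* set_type A as a metric space, pointed thanks to A0: carriers of
   measurableType are pointed. *)
Definition metric_subspace {T : Type} {A : set T} (A0 : A !=set0) : Type := A.

Section metric_subspace.
Context {R : realType} {T : metricType R} {A : set T} (A0 : A !=set0).

HB.instance Definition _ := Metric.copy (metric_subspace A0) (set_type A).

HB.instance Definition _ := isPointed.Build (metric_subspace A0)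
  (exist _ (projT1 (cid A0)) (mem_set (projT2 (cid A0)))).

End metric_subspace.

(* S equipped with its Borel sigma-field. For a product S1 * S2 this is the
   Borel sigma-field of the product topology. *)
Notation borel S := (g_sigma_algebraType (@open S)).

Definition bounded_continuous (R : realType) (S : topologicalType) :
  set (S -> R) := [set f | bounded_fun f /\ continuous f].
Arguments bounded_continuous : clear implicits.

Section weak_convergence.
Context {R : realType} {S : ptopologicalType}.

Definition weakly_converges (mu_ : nat -> probability (borel S) R)
    (mu : probability (borel S) R) : Prop :=
  forall f, bounded_continuous R S f ->
    \int[mu_ n]_x f x @[n --> \oo] --> \int[mu]_x f x.

Definition determines_weak_convergence (F : set (S -> R)) : Prop :=
  forall (mu_ : nat -> probability (borel S) R) (mu : probability (borel S) R),
    weakly_converges mu_ mu <->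
    (forall f, F f -> \int[mu_ n]_x f x @[n --> \oo] --> \int[mu]_x f x).

End weak_convergence.

Section slice.
Context {S1 S2 : ptopologicalType}.

Let measurable_fst_borel :
  measurable_fun setT (fst : borel (S1 * S2)%type -> borel S1).
Proof.
apply: measurability; first by [].
move=> _ [U oU <-]; rewrite setTI; apply: sub_sigma_algebra.
by apply: open_comp => // x _; exact: cvg_fst.
Qed.

Let measurable_snd_borel :
  measurable_fun setT (snd : borel (S1 * S2)%type -> borel S2).
Proof.
apply: measurability; first by [].
move=> _ [U oU <-]; rewrite setTI; apply: sub_sigma_algebra.
by apply: open_comp => // x _; exact: cvg_snd.
Qed.

Lemma measurable_borelX (A : set (borel S1)) (B : set (borel S2)) :
  measurable A -> measurable B ->
  measurable (A `*` B : set (borel (S1 * S2)%type)).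
Proof.
move=> mA mB; rewrite -[A `*` B]/(fst @^-1` A `&` snd @^-1` B).
apply: measurableI.
- by rewrite -[X in measurable X]setTI; exact: measurable_fst_borel.
- by rewrite -[X in measurable X]setTI; exact: measurable_snd_borel.
Qed.

Context {R : realType}.
Variable mu : {measure set (borel (S1 * S2)%type) -> \bar R}.
Variables (B : set (borel S2)) (mB : measurable B).

(* The measure written mu(ds1, B). *)
Definition slice of measurable B : set (borel S1) -> \bar R :=
  fun A => mu (A `*` B).

Local Notation sliceB := (slice mB).

Let slice0 : sliceB set0 = 0%E.
Proof. by rewrite /slice set0X measure0. Qed.

Let slice_ge0 A : (0 <= sliceB A)%E.
Proof. exact: measure_ge0. Qed.

Let slice_sigma_additive : semi_sigma_additive sliceB.
Proof.
move=> F mF tF mUF; rewrite /slice setX_bigcupl.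
apply: measure_semi_sigma_additive.
- by move=> n; exact: measurable_borelX.
- apply/trivIsetP => i j _ _ ij; rewrite -setXI.
  by move/trivIsetP : tF => /(_ _ _ _ _ ij) ->//; rewrite set0X.
- by rewrite -setX_bigcupl; exact: measurable_borelX.
Qed.

HB.instance Definition _ := isMeasure.Build _ _ _ sliceB
  slice0 slice_ge0 slice_sigma_additive.

End slice.

Section semi_uniform_feller.
Context {R : realType} {S1 S2 S3 : ptopologicalType}.
Variable Psi : R.-pker borel S3 ~> borel (S1 * S2)%type.

Definition slice_gap (f : S1 -> R) (s t : S3) : \bar R :=
  ereal_sup [set x | exists (B : set (borel S2)) (mB : measurable B),
    x = `| \int[slice (Psi s) mB]_s1 f s1
           - \int[slice (Psi t) mB]_s1 f s1 |%:E].

Definition slice_convergent (f : S1 -> R) : Prop :=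
  forall (s_ : nat -> S3) (s : S3), s_ n @[n --> \oo] --> s ->
    slice_gap f (s_ n) s @[n --> \oo] --> 0%E.

Definition semi_uniform_feller : Prop :=
  forall f, bounded_continuous R S1 f -> slice_convergent f.

End semi_uniform_feller.

(* Main.v *)
Require Import Defs.
From HB Require Import structures.
From mathcomp Require Import all_boot all_order all_algebra.
From mathcomp Require Import all_classical all_reals all_analysis.
From mathcomp Require Import measurable_realfun.
From mathcomp Require Import lra.

(* Sufficiency: for Borel sets B_n, the measures
   Psi(ds1, B_n | s_n) + Psi(ds1, S2 \ B_n | s) differ from the fixed
   probability Psi(ds1, S2 | s) by exactly
   Psi(ds1, B_n | s_n) - Psi(ds1, B_n | s). On F their integrals therefore
   converge to those of the fixed probability; since 1 is in F their masses tend
   to 1, so after normalisation F detects their weak convergence, which extends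
   the convergence from F to all bounded continuous functions. As B_n may violate
   a given bound whenever some B does, the convergence is uniform in B.

   Necessity: on a separable metric space, finite maxima of 0 and rational
   cones q - k d(., e_i), with e_i ranging over a dense sequence, form a countable
   family from which every nonnegative continuous f is an increasing limit. Hence
   convergence on this family gives liminf mu_n(f) >= mu(f); applying this to
   M + f and M - f, with M a bound of |f|, gives weak convergence. *)

Set Implicit Arguments.
Unset Strict Implicit.
Unset Printing Implicit Defensive.

Import Order.TTheory GRing.Theory Num.Theory.
Import numFieldNormedType.Exports.

Local Open Scope classical_set_scope.
Local Open Scope ring_scope.

(** * Bounded continuous functions and finite Borel measures *)

Lemma bounded_fun_le (R : realType) (S : Type) (f : S -> R) :
  bounded_fun f -> exists2 M, 0 < M & forall x, `|f x| <= M.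
Proof.
move=> /pinfty_ex_gt0[M M0 fM]; exists M => // x.
exact: fM.
Qed.

Lemma le_bounded_fun (R : realType) (S : Type) (f : S -> R) (M : R) :
  (forall x, `|f x| <= M) -> bounded_fun f.
Proof.
move=> fM; exists M; split; first exact: num_real.
by move=> N MN x _ /=; rewrite (le_trans (fM x))// ltW.
Qed.

Lemma continuous_borel_measurable (R : realType) (S : ptopologicalType)
    (f : S -> R) : continuous f -> measurable_fun setT (f : borel S -> R).
Proof.
move=> /continuousP cf.
apply: (measurability _ (RGenOpens.measurableE R)) => _ [_ [a [b ->]] <-].
by rewrite setTI; apply: sub_sigma_algebra; apply: cf; exact: interval_open.
Qed.

Section finite_borel_measures.
Context {R : realType} {S : ptopologicalType}.
Implicit Types (mu : {measure set (borel S) -> \bar R}) (f : S -> R).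

Lemma bounded_continuous_integrable mu f : (mu setT < +oo)%E ->
  bounded_continuous R S f -> mu.-integrable setT (EFin \o f).
Proof.
move=> muoo [bf cf]; apply: measurable_bounded_integrable => //.
exact: continuous_borel_measurable.
Qed.

Lemma bounded_continuousD f (c : R) :
  bounded_continuous R S f -> bounded_continuous R S (fun x => f x + c).
Proof.
move=> [/bounded_fun_le[M M0 fM] cf]; split.
  apply: (@le_bounded_fun _ _ _ (M + `|c|)) => x.
  by rewrite (le_trans (ler_normD _ _))// lerD.
by move=> x; apply: cvgD; [exact: cf|exact: cvg_cst].
Qed.

Lemma bounded_continuousN f :
  bounded_continuous R S f -> bounded_continuous R S (fun x => - f x).
Proof.
move=> [/bounded_fun_le[M M0 fM] cf]; split.
  by apply: (@le_bounded_fun _ _ _ M) => x; rewrite normrN.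
by move=> x; apply: cvgN; exact: cf.
Qed.

Lemma bounded_continuous_cst (c : R) : bounded_continuous R S (cst c).
Proof.
split; last by move=> x; exact: cvg_cst.
by apply: (@le_bounded_fun _ _ _ `|c|).
Qed.

Lemma Rintegral_bounded_continuousDcst (mu : probability (borel S) R) f
    (c : R) : bounded_continuous R S f ->
  \int[mu]_x (f x + c) = \int[mu]_x f x + c.
Proof.
move=> bf; have muoo : (mu setT < +oo)%E by rewrite probability_setT ltry.
rewrite (RintegralD _ (bounded_continuous_integrable muoo bf)
  (bounded_continuous_integrable muoo (bounded_continuous_cst c)))//.
by rewrite (Rintegral_cst mu)//= (@probability_setT _ _ _ mu) mulr1.
Qed.

Lemma Rintegral_bounded_continuousN (mu : probability (borel S) R) f :
  bounded_continuous R S f -> \int[mu]_x (- f x) = - \int[mu]_x f x.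
Proof.
move=> bf; have muoo : (mu setT < +oo)%E by rewrite probability_setT ltry.
under eq_Rintegral do rewrite -mulN1r.
by rewrite RintegralZl ?mulN1r//; exact: bounded_continuous_integrable.
Qed.

Lemma integral_mnormalize mu (P : probability (borel S) R) f :
  mu setT != 0%E -> (mu setT < +oo)%E -> bounded_continuous R S f ->
  \int[mnormalize mu P]_x f x = (\int[mu]_x f x) / fine (mu setT).
Proof.
move=> mu0 muoo bf.
have ifmu := bounded_continuous_integrable muoo bf.
have k0 : 0 <= (fine (mu setT))^-1 by rewrite invr_ge0 fine_ge0.
rewrite /Rintegral -[_^-1]/(fine (_^-1)%:E) mulrC -fineM//; last first.
  exact: integrable_fin_num.
congr fine; rewrite (@eq_measure_integral _ _ _ _ (mscale (NngNum k0) mu)).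
  (* The scaling rule is for nonnegative integrands, so the integral is split into positive and
     negative parts; integrability excludes an undefined difference when the factor is pulled out
     again. *)
  have mf := measurable_int _ ifmu.
  rewrite integralE !ge0_integral_mscale//; last 2 first.
  - exact: measurable_funeneg.
  - exact: measurable_funepos.
  rewrite -muleBr//= -?integralE//.
  apply: fin_num_adde_defr.
  exact: integrable_pos_fin_num.
move=> A mA _; rewrite /= /mnormalize /= /mscale/=.
by rewrite (negbTE mu0) (lt_eqF muoo)/= muleC.
Qed.

End finite_borel_measures.

Lemma determines_finite_measures (R : realType) (S : ptopologicalType)
    (F : set (S -> R)) (mu_ : nat -> {measure set (borel S) -> \bar R})
    (mu : probability (borel S) R) :
  F `<=` bounded_continuous R S -> determines_weak_convergence F -> F (cst 1) ->
  (forall n, mu_ n setT < +oo)%E ->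
  (forall f, F f -> \int[mu_ n]_x f x @[n --> \oo] --> \int[mu]_x f x) ->
  forall f, bounded_continuous R S f ->
    \int[mu_ n]_x f x @[n --> \oo] --> \int[mu]_x f x.
Proof.
move=> Fbc detF F1 mu_oo muF.
pose m n := fine (mu_ n setT).
have m1 : m n @[n --> \oo] --> (1 : R).
  have := muF _ F1; rewrite (Rintegral_cst mu)//= (@probability_setT _ _ _ mu) mulr1.
  by under eq_cvg do rewrite (Rintegral_cst (mu_ _))// mul1r.
have m_gt0 : \forall n \near \oo, 0 < m n by exact: (cvgr_gt _ m1).
(* The identity can fail where the mass is 0, since [mnormalize] then returns its default [mu]; as
   [m n] tends to 1, this concerns only finitely many [n]. *)
have normE f : bounded_continuous R S f ->
    \forall n \near \oo,
      \int[mnormalize (mu_ n) mu]_x f x = \int[mu_ n]_x f x / m n.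
  move=> bf; near=> n; rewrite integral_mnormalize//.
  apply/eqP => mu0; have : 0 < m n by near: n.
  by rewrite /m mu0 ltxx.
have weak : weakly_converges (fun n => mnormalize (mu_ n) mu) mu.
  apply/detF => f Ff.
  have : \int[mu_ n]_x f x / m n @[n --> \oo] --> \int[mu]_x f x / 1.
    by apply: cvgM; [exact: muF|apply: cvgV => //; exact: oner_neq0].
  rewrite divr1; apply: cvg_trans; apply: near_eq_cvg.
  by near=> n; apply/esym; near: n; exact/normE/Fbc.
move=> f bf.
have : \int[mnormalize (mu_ n) mu]_x f x * m n @[n --> \oo]
    --> \int[mu]_x f x * 1.
  by apply: cvgM => //; exact: weak.
rewrite mulr1; apply: cvg_trans; apply: near_eq_cvg; near=> n.
have -> : \int[mnormalize (mu_ n) mu]_x f x = \int[mu_ n]_x f x / m n.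
  by near: n; exact: normE.
by rewrite divfK// gt_eqF//; near: n.
Unshelve. all: by end_near. Qed.

(** * Slices of a measure on a product, and convergence uniform in the Borel set *)

Section slices.
Context {R : realType} {S1 S2 : ptopologicalType}.
Implicit Types mu : {measure set (borel (S1 * S2)%type) -> \bar R}.

Lemma slice_finite mu (B : set (borel S2)) (mB : measurable B) :
  (mu setT < +oo)%E -> (slice mu mB setT < +oo)%E.
Proof.
apply: le_lt_trans; apply: le_measure => //; rewrite inE//.
exact: measurable_borelX.
Qed.

(** Packs the first marginal as a [probability], the only type of limit that
    [determines_weak_convergence] accepts. *)
Lemma slice_setT_probability mu : mu setT = 1%E ->
  exists P : probability (borel S1) R,
    forall A, P A = slice mu (@measurableT _ (borel S2)) A.
Proof.
move=> mu1; pose m := slice mu (@measurableT _ (borel S2)).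
have m1 : m setT = 1%E by rewrite /m /slice setXTT.
pose p := Measure_isProbability.Build _ _ R m m1.
pose P : probability (borel S1) R := HB.pack m p.
by exists P.
Qed.

Lemma slice_setC mu (B : set (borel S2)) (mB : measurable B)
    (A : set (borel S1)) : measurable A ->
  (slice mu mB A + slice mu (measurableC mB) A =
    slice mu (@measurableT _ (borel S2)) A)%E.
Proof.
move=> mA; rewrite /slice -measureU//.
- congr (mu _); apply/seteqP; split=> [x [[]|[]]|x []]//= Ax _.
  by have [] := pselect (B x.2); [left|right].
- exact: measurable_borelX.
- by apply: measurable_borelX => //; exact: measurableC.
- by rewrite -setXI setICr setX0.
Qed.

End slices.

(** The bound is non-strict so that it can be checked on each member of a supremum such as
    [slice_gap], which might a priori be infinite. *)
Lemma cvge0P (R : realType) (u : nat -> \bar R) : (forall n, 0 <= u n)%E ->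
  u n @[n --> \oo] --> 0%E <->
  forall e : R, 0 < e -> \forall n \near \oo, (u n <= e%:E)%E.
Proof.
move=> u0; split=> [/fine_cvgP[ufin uc] e e0|ue].
  near=> n; have ufn : u n \is a fin_num by near: n.
  rewrite -(fineK ufn) lee_fin; apply: (le_trans (ler_norm _)).
  rewrite -normrN -[- _]add0r; near: n.
  by move/cvgrPdist_le : uc; exact.
apply/fine_cvgP; split.
  near=> n; rewrite ge0_fin_numE//; apply: (@le_lt_trans _ _ 1%:E).
    by near: n; exact: ue.
  exact: ltry.
apply/cvgrPdist_le => e e0; near=> n.
have une : (u n <= e%:E)%E by near: n; exact: ue.
have ufn : u n \is a fin_num.
  by rewrite ge0_fin_numE// (le_lt_trans une)// ltry.
rewrite sub0r normrN ger0_norm /= ?fine_ge0//.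
by rewrite -lee_fin fineK.
Unshelve. all: by end_near. Qed.

Section slice_convergence.
Context {R : realType} {S1 S2 S3 : ptopologicalType}.
Variable Psi : R.-pker borel S3 ~> borel (S1 * S2)%type.

(** Trades the supremum over Borel sets for an arbitrary sequence of sets: given [e], a sequence
    that violates the bound [e] at every [n] where this is possible is the worst case. *)
Lemma slice_convergentP (f : S1 -> R) : slice_convergent Psi f <->
  forall (s_ : nat -> S3) (s : S3), s_ n @[n --> \oo] --> s ->
    forall (B_ : nat -> set (borel S2)) (mB_ : forall n, measurable (B_ n)),
      \int[slice (Psi (s_ n)) (mB_ n)]_x f x
        - \int[slice (Psi s) (mB_ n)]_x f x @[n --> \oo] --> (0 : R).
Proof.
have gap_ub s t (B : set (borel S2)) (mB : measurable B) :
    (`|\int[slice (Psi s) mB]_x f x - \int[slice (Psi t) mB]_x f x|%:E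
     <= slice_gap Psi f s t)%E.
  by apply: ereal_sup_ubound; exists B, mB.
have gap0 s t : (0 <= slice_gap Psi f s t)%E.
  by apply: le_trans (gap_ub s t _ measurable0); rewrite lee_fin.
split=> cf s_ s s_s.
  move=> B_ mB_; apply/cvgrPdist_le => e e0.
  have /cvge0P-/(_ (fun=> gap0 _ _) e e0) := cf s_ s s_s.
  apply: filterS => n; rewrite sub0r normrN -lee_fin.
  exact: le_trans.
apply/cvge0P => // e e0.
pose bad n (B : {B : set (borel S2) | measurable B}) :=
  e < `|\int[slice (Psi (s_ n)) (projT2 B)]_x f x
        - \int[slice (Psi s) (projT2 B)]_x f x|.
have /choice[B_ BP] : forall n, exists B, (exists B', bad n B') -> bad n B.
  move=> n; have [[B Bbad]|nobad] := pselect (exists B, bad n B).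
    by exists B.
  (* When no set is bad at [n], any measurable set will do. *)
  by exists (exist _ set0 measurable0).
have /cvgrPdist_le-/(_ e e0) := cf s_ s s_s _ (fun n => projT2 (B_ n)).
apply: filterS => n; rewrite sub0r normrN => good.
apply: ge_ereal_sup => _ [B [mB ->]]; rewrite lee_fin leNgt; apply/negP => bB.
have /BP : exists B', bad n B' by exists (exist _ B mB).
by rewrite /bad ltNge good.
Qed.

Lemma semi_uniform_feller_determined (F : set (S1 -> R)) :
  F `<=` bounded_continuous R S1 -> determines_weak_convergence F ->
  F (cst 1) -> (forall f, F f -> slice_convergent Psi f) ->
  semi_uniform_feller Psi.
Proof.
move=> Fbc detF F1 FPsi f bf.
apply/slice_convergentP => s_ s s_s B_ mB_.
have Psi_oo t (B : set (borel S2)) (mB : measurable B) :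
    (slice (Psi t) mB setT < +oo)%E.
  by apply: slice_finite; rewrite prob_kernel ltry.
have [P PE] := slice_setT_probability (prob_kernel (s := Psi) s).
(* The difference of the slices over [B_ n] at [s_ n] and at [s] may be signed; adding the marginal
   [P] at [s] turns it into this genuine measure. *)
pose rho n := measure_add (slice (Psi (s_ n)) (mB_ n))
  (slice (Psi s) (measurableC (mB_ n))).
have rhoE g n : bounded_continuous R S1 g -> 
    \int[slice (Psi (s_ n)) (mB_ n)]_x g x
    - \int[slice (Psi s) (mB_ n)]_x g x = \int[rho n]_x g x - \int[P]_x g x.
  move=> bg.
  have addE t u (B B' : set (borel S2)) (mB : measurable B)
      (mB' : measurable B') :
      \int[measure_add (slice (Psi t) mB) (slice (Psi u) mB')]_x g x =
      \int[slice (Psi t) mB]_x g x + \int[slice (Psi u) mB']_x g x.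
    have i1 := bounded_continuous_integrable (Psi_oo t _ mB) bg.
    have i2 := bounded_continuous_integrable (Psi_oo u _ mB') bg.
    by rewrite /Rintegral integral_measure_add// fineD//;
      exact: integrable_fin_num.
  (* Once [P] is split over [B_ n] and its complement at [s], the complement terms cancel. *)
  have -> : \int[P]_x g x = \int[measure_add (slice (Psi s) (mB_ n))
      (slice (Psi s) (measurableC (mB_ n)))]_x g x.
    congr fine; apply: eq_measure_integral => A mA _.
    apply: etrans (PE A) _; apply: etrans (esym (measure_addE _ _ _)).
    exact/esym/slice_setC.
  by rewrite /rho !addE opprD addrACA subrr addr0.
have rho_cvg g : bounded_continuous R S1 g ->
    \int[rho n]_x g x @[n --> \oo] --> \int[P]_x g x <->
    \int[slice (Psi (s_ n)) (mB_ n)]_x g x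
      - \int[slice (Psi s) (mB_ n)]_x g x @[n --> \oo] --> (0 : R).
  move=> bg; rewrite (funext (fun n => rhoE g n bg)).
  exact: iff_sym (subr_cvg0 _ _).
apply/(rho_cvg _ bf); apply: (determines_finite_measures Fbc) => //.
  move=> n; apply: (eq_ind_r (fun m => m < +oo)%E _ (measure_addE _ _ _)).
  by rewrite lte_add_pinfty//; exact: Psi_oo.
move=> g Fg; apply/rho_cvg; first exact: Fbc.
exact: (slice_convergentP g).1 (FPsi _ Fg) _ _ s_s _ _.
Qed.

End slice_convergence.

(** * Countable families that determine weak convergence *)

Section lower_approximation.
Context {R : realType} {S : ptopologicalType}.

(** Monotone convergence gives one [m] for which the [mu]-integral of [h m] is within [e / 2] of
    that of [f]. For this fixed [m], convergence of the integrals costs another [e / 2], and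
    [h m <= f] concludes. *)
Lemma weak_lower_bound (mu_ : nat -> probability (borel S) R)
    (mu : probability (borel S) R) (h : nat -> S -> R) (f : S -> R) :
  (forall m, bounded_continuous R S (h m)) -> bounded_continuous R S f ->
  (forall m x, 0 <= h m x <= f x) ->
  (forall x, {homo h ^~ x : m n / (m <= n)%N >-> m <= n}) ->
  (forall x, h m x @[m --> \oo] --> f x) ->
  (forall m, \int[mu_ n]_x h m x @[n --> \oo] --> \int[mu]_x h m x) ->
  forall e, 0 < e ->
    \forall n \near \oo, \int[mu]_x f x - e < \int[mu_ n]_x f x.
Proof.
move=> bh bf hf hnd hcvg muh e e0.
have prob_oo (P : probability (borel S) R) : (P setT < +oo)%E.
  by rewrite probability_setT ltry.
have hint (P : probability (borel S) R) m :=
  bounded_continuous_integrable (prob_oo P) (bh m).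
have fint (P : probability (borel S) R) :=
  bounded_continuous_integrable (prob_oo P) bf.
have intfE : (\int[mu]_x (f x)%:E =
    \int[mu]_x (limn (fun m => (h m x)%:E)))%E.
  apply: eq_integral => x _; apply/esym/cvg_lim => //.
  by apply/fine_cvgP; split; [exact: nearW|exact: hcvg].
have hmu : \int[mu]_x h m x @[m --> \oo] --> \int[mu]_x f x.
  apply: fine_cvg; rewrite fineK; last exact: integrable_fin_num.
  rewrite intfE.
  apply: (@cvg_monotone_convergence _ _ _ mu setT _ (fun m x => (h m x)%:E)).
  - by [].
  - by move=> m; exact: measurable_int (hint mu m).
  - by move=> m x _; rewrite lee_fin; case/andP: (hf m x).
  - by move=> x _ m n mn; rewrite lee_fin; exact: hnd.
have e20 : 0 < e / 2 by rewrite divr_gt0.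
have ltB a : a - e / 2 < a by rewrite ltrBlDr ltrDl.
have [m _ /(_ m (leqnn m)) /= hm] := cvgr_gt _ hmu _ (ltB _).
near=> n.
have hmn : \int[mu]_x h m x - e / 2 < \int[mu_ n]_x h m x.
  by near: n; exact: (cvgr_gt _ (muh m)).
apply: (@lt_le_trans _ _ (\int[mu_ n]_x h m x)).
  by apply: lt_trans hmn; lra.
by apply: le_Rintegral => // x _; case/andP: (hf m x).
Unshelve. all: by end_near. Qed.

Lemma determines_of_lower_approximation (F : set (S -> R)) :
  F `<=` bounded_continuous R S ->
  (forall f, bounded_continuous R S f -> (forall x, 0 <= f x) ->
    exists h : nat -> S -> R,
      [/\ forall m, F (h m), forall m x, 0 <= h m x <= f x,
          forall x, {homo h ^~ x : m n / (m <= n)%N >-> m <= n} &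
          forall x, h m x @[m --> \oo] --> f x]) ->
  determines_weak_convergence F.
Proof.
move=> Fbc Fapprox mu_ mu; split=> [w f Ff|muF f bf]; first exact/w/Fbc.
have lower g : bounded_continuous R S g -> (forall x, 0 <= g x) ->
    forall e, 0 < e ->
    \forall n \near \oo, \int[mu]_x g x - e < \int[mu_ n]_x g x.
  move=> bg g0; have [h [Fh hg hnd hcvg]] := Fapprox g bg g0.
  by apply: (weak_lower_bound (h := h)) => // m; [exact: Fbc|exact: muF].
have [M M0 fM] := bounded_fun_le bf.1.
have bNf := bounded_continuousN bf.
apply/cvgrPdist_lt => e e0.
(* Adding [M] makes both [f] and [- f] nonnegative, and shifts the integral by [M] under every
   probability, so the two lower bounds become a two-sided one. *)
have := lower _ (bounded_continuousD M bf) _ e e0.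
have := lower _ (bounded_continuousD M bNf) _ e e0.
move=> near1 near2; near=> n.
have : \int[mu]_x (- f x + M) - e < \int[mu_ n]_x (- f x + M).
  near: n; apply: near1 => x; rewrite addrC subr_ge0.
  exact: le_trans (ler_norm _) (fM x).
have : \int[mu]_x (f x + M) - e < \int[mu_ n]_x (f x + M).
  near: n; apply: near2 => x; rewrite -lerBlDr sub0r.
  by have := fM x; rewrite ler_norml => /andP[].
rewrite !Rintegral_bounded_continuousDcst// !Rintegral_bounded_continuousN//.
by rewrite ltr_norml; lra.
Unshelve. all: by end_near. Qed.

Lemma continuous_bigmax (I : Type) (r : seq I) (c : I -> S -> R) (a : R) :
  (forall i, continuous (c i)) ->
  continuous (fun x : S => \big[Num.max/a]_(i <- r) c i x : R).
Proof.
move=> cc; elim: r => [|i r ih] x.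
  by under eq_fun do rewrite big_nil; exact: cvg_cst.
under eq_fun do rewrite big_cons.
by apply: (@continuous_max R S); [exact: cc|exact: ih].
Qed.

(** The [c i] need not be bounded below; taking maxima with 0 repairs this and gives the
    nonnegativity needed for monotone convergence. Finite sequences over a countable type keep the
    family countable. *)
Lemma countable_determining_bigmax (I : countType) (c : I -> S -> R) :
  (forall i, continuous (c i)) -> (forall i, exists M, forall x, c i x <= M) ->
  (forall f : S -> R, continuous f -> (forall x, 0 <= f x) -> forall x e, 0 < e ->
    exists2 i, (forall y, c i y <= f y) & f x - e < c i x) ->
  exists F : set (S -> R), [/\ countable F, F `<=` bounded_continuous R S &
    determines_weak_convergence F].
Proof.
move=> cc cub capprox.
pose G (s : seq I) (x : S) := \big[Num.max/0]_(i <- s) c i x.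
have G0 s x : 0 <= G s x by exact: bigmax_ge_id.
have Gle s x M : 0 <= M -> (forall i, i \in s -> c i x <= M) -> G s x <= M.
  move=> M0; rewrite /G big_seq => sM.
  by apply: bigmax_le.
have Gub s : exists M, forall x, G s x <= M.
  have [M cM] := choice cub.
  exists (\big[Num.max/0]_(i <- s) M i) => x; apply: Gle.
    exact: bigmax_ge_id.
  by move=> i si; apply: bigmax_sup_seq (cM i x).
have Gbc : range G `<=` bounded_continuous R S.
  move=> _ [s _ <-]; split; last exact: continuous_bigmax.
  by have [M GM] := Gub s; apply: (@le_bounded_fun _ _ _ M) => x; rewrite ger0_norm.
exists (range G); split => //; first exact: sub_countable (card_image_le _ _) _.
apply: determines_of_lower_approximation => // f bf f0.
pose below i := `[< forall y, c i y <= f y >].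
(* The indices with code less than [m] whose function lies below [f]: these lists grow with [m], and
   each admissible [i] belongs to them from [m = pickle i + 1] on. *)
pose s m := [seq i <- pmap (@unpickle I) (iota 0 m) | below i].
have s_sub m n : (m <= n)%N -> {subset s m <= s n}.
  move=> mn i; rewrite !mem_filter => /andP[-> ] /=.
  rewrite !mem_pmap => /mapP[k]; rewrite mem_iota => /= km ->.
  by apply: map_f; rewrite mem_iota /= (leq_trans km).
have Gf m x : G (s m) x <= f x.
  apply: Gle => // i; rewrite mem_filter => /andP[/asboolP] + _; exact.
exists (fun m => G (s m)); split.
- by move=> m; exists (s m).
- by move=> m x; rewrite G0 Gf.
- by move=> x m n mn; apply: sub_bigmax_seq; exact: s_sub.
- move=> x; apply/cvgrPdist_lt => e e0.
  have [i cf fc] := capprox f bf.2 f0 x e e0.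
  exists (pickle i).+1 => // m /= im.
  rewrite ger0_norm ?subr_ge0// ltrBlDr -ltrBlDl.
  apply: lt_le_trans fc _; apply: (@le_bigmax_seq _ _ _ _ _ i) => //.
  rewrite mem_filter; apply/andP; split; first exact/asboolP.
  rewrite mem_pmap; apply/mapP; exists (pickle i); last by rewrite pickleK.
  by rewrite mem_iota.
Qed.

End lower_approximation.

(** * Cones on a separable metric space *)

Definition cone (R : realType) (S : metricType R) (I : Type) (e : I -> S)
  (t : I * rat * nat) (x : S) : R := ratr t.1.2 - t.2%:R * mdist x (e t.1.1).

Section cones.
Context {R : realType} {S : metricType R} (I : Type) (e : I -> S).

Lemma continuous_cone t : continuous (cone e t).
Proof.
move=> x; apply: cvgB; first exact: cvg_cst.
apply: cvgM; first exact: cvg_cst.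
apply/cvgrPdist_lt => d d0; apply/nbhs_ballP; exists d => // y.
rewrite ballEmdist /= => xy; rewrite ltr_norml; apply/andP; split.
  by have := metric_triangle y x (e t.1.1); rewrite (metric_sym y x); lra.
by have := metric_triangle x y (e t.1.1); lra.
Qed.

Lemma cone_le t x : cone e t x <= ratr t.1.2.
Proof. by rewrite /cone gerBl mulr_ge0 ?ler0n ?mdist_ge0. Qed.

(** Within distance [r] of [x], continuity keeps [f] above the height [q] of the cone; farther away,
    a steep enough cone is already negative, hence below [f]. An apex close to [x] makes the loss at
    [x] small. *)
Lemma cone_lower_approximation :
  (forall x d, 0 < d -> exists i, mdist x (e i) < d) ->
  forall f : S -> R, continuous f -> (forall x, 0 <= f x) ->
  forall x d, 0 < d ->
    exists2 t, (forall y, cone e t y <= f y) & f x - d < cone e t x.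
Proof.
move=> e_dense f cf f0 x d d0.
have d20 : 0 < d / 2 by rewrite divr_gt0.
have /nbhs_ballP[r /= r0 fr] : \forall y \near x, `|f x - f y| < d / 2.
  by move/cvgrPdist_lt : (cf x); exact.
have [q] : exists q : rat, ratr q \in `]f x - d, f x - d / 2[.
  by apply: rat_in_itvoo; lra.
rewrite in_itv /= => /andP[fq qf].
(* This slope brings the cone below 0 at distance [r / 2] from its apex. *)
pose k := (Num.truncn (ratr q / (r / 2))).+1.
have k0 : 0 < k%:R :> R by rewrite ltr0n.
have qk : ratr q < k%:R * (r / 2) by rewrite -ltr_pdivrMr ?divr_gt0// truncnS_gt.
(* The first bound leaves points outside the ball at distance more than [r / 2] from the apex; the
   second makes the drop at [x] less than [q - (f x - d)]. *)
have [|i] := e_dense x (Num.min (r / 2) ((ratr q - (f x - d)) / k%:R)).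
  by rewrite lt_min !divr_gt0 ?subr_gt0.
rewrite lt_min => /andP[ir]; rewrite ltr_pdivlMr// mulrC => ik.
exists (i, q, k); last by rewrite /cone /= ltrBrDr addrC -ltrBrDr.
move=> y; have [xy|xy] := ltP (mdist x y) r.
  apply: le_trans (cone_le _ _) _ => /=.
  have /fr : ball x r y by rewrite ballEmdist.
  by rewrite ltr_norml => /andP[]; lra.
apply: le_trans (f0 y); rewrite /cone /= subr_le0.
apply: le_trans (ltW qk) _; rewrite ler_pM2l//.
by have := metric_triangle x (e i) y; rewrite (metric_sym (e i)); lra.
Qed.

End cones.

(** [D] may miss [A] altogether, so for each [z] in [D] and each [k] a point of [A] within
    [1 / (k + 1)] of [z] is selected if there is one. The index pairs the code of [z] with [k]. *)
Lemma metric_subspace_separable (R : realType) (T : metricType R) (A : set T)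
    (A0 : A !=set0) : (exists2 D : set T, countable D & dense D) ->
  exists e : nat * nat -> metric_subspace A0,
    forall x d, 0 < d -> exists i, mdist x (e i) < d.
Proof.
move=> [D /countable_injP[g injg] denseD].
pose close (p : nat * nat) (y : metric_subspace A0) :=
  exists2 z, D z & g z = p.1 /\ mdist z (set_val y) < p.2.+1%:R^-1.
have /choice[e eP] : forall p, exists y, (exists y', close p y') -> close p y.
  move=> p; have [[y py]|no] := pselect (exists y, close p y).
    by exists y.
  by exists point.
exists e => x d d0.
have d20 : 0 < d / 2 by rewrite divr_gt0.
(* Both [x] and the selected point are within [1 / (k + 1) < d / 2] of the same [z]. *)
pose k := Num.truncn (d / 2)^-1.
have kd : k.+1%:R^-1 < d / 2.
  by rewrite -[ltRHS]invrK ltf_pV2 ?posrE ?invr_gt0 ?ltr0n// truncnS_gt.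
have [z [xz Dz]] : ball (set_val x) k.+1%:R^-1 `&` D !=set0.
  have xball : nbhs (set_val x) (ball (set_val x) k.+1%:R^-1).
    by apply: nbhsx_ballx; rewrite invr_gt0 ltr0n.
  have [|z [zx Dz]] := denseD _ _ (open_interior (ball (set_val x) k.+1%:R^-1)).
    by exists (set_val x).
  by exists z; split => //; exact: interior_subset zx.
have [|z' Dz' [gz' zz']] := eP (g z, k).
  exists x, z => //; split => //.
  by move: xz; rewrite ballEmdist /= metric_sym.
have zE : z' = z by apply: injg => //; rewrite ?inE.
exists (g z, k); apply: (le_lt_trans (metric_triangle (set_val x) z (set_val _))).
rewrite (splitr d); apply: ltrD; apply: lt_trans kd.
  by move: xz; rewrite ballEmdist.
by move: zz'; rewrite zE.
Qed.

Theorem theorem4 (R : realType) (T1 T2 T3 : metricType R)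
  (T1_polish : polish T1) (T2_polish : polish T2) (T3_polish : polish T3)
  (A1 : set T1) (A2 : set T2) (A3 : set T3)
  (A1_borel : borel_sets A1) (A2_borel : borel_sets A2)
  (A3_borel : borel_sets A3)
  (A1_neq0 : A1 !=set0) (A2_neq0 : A2 !=set0) (A3_neq0 : A3 !=set0)
  (S1 := metric_subspace A1_neq0) (S2 := metric_subspace A2_neq0)
  (S3 := metric_subspace A3_neq0)
  (Psi : R.-pker borel S3 ~> borel (S1 * S2)%type) :
  semi_uniform_feller Psi <->
  exists F : set (S1 -> R),
    [/\ countable F, F `<=` bounded_continuous R S1,
        determines_weak_convergence F, F (cst 1) &
        forall f, F f -> slice_convergent Psi f].
Proof.
split=> [feller|[F [_ Fbc detF F1 FPsi]]]; last first.
  exact: semi_uniform_feller_determined FPsi.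
have [e e_dense] := metric_subspace_separable A1_neq0 T1_polish.1.
have [F [cF Fbc detF]] := @countable_determining_bigmax R S1 _ (cone e)
  (@continuous_cone R S1 _ e) (fun t => ex_intro _ _ (cone_le e t))
  (cone_lower_approximation e_dense).
(* The constant 1 is adjoined by hand; a determining family stays determining when bounded
   continuous functions are added. *)
have F1bc : F `|` [set cst 1] `<=` bounded_continuous R S1.
  by move=> f [/Fbc//|->]; exact: bounded_continuous_cst.
exists (F `|` [set cst 1]); split => //.
- by rewrite -bigcup2E; apply: bigcup_countable => // -[|[|i]] _ /=.
- move=> mu_ mu; split=> [w f /F1bc|FP]; first exact: w.
  by apply/detF => f Ff; apply: FP; left.
- by right.
- by move=> f /F1bc; exact: feller.
Qed.
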